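(* Let $N\in\mathbb N$, $q\in(0,1)$, $\tau>0$, $r<1$. The commit protocol $\textsc{commit}^{\mathsf{1CC}}_{N,q,\tau,r}$ described in the context is $2^{-\frac12 N(\log_2(1/\gamma)-2q-(1-r))}$-hiding, where $\gamma=\cos^2(\pi/8)$.
   Context: Notation: for $b,a\in\{0,1\}$, $|b\rangle_0$ is the computational basis vector $|b\rangle$ and $|b\rangle_1$ the diagonal basis vector, $|0\rangle_1=\frac1{\sqrt2}(|0\rangle+|1\rangle)$, $|1\rangle_1=\frac1{\sqrt2}(|0\rangle-|1\rangle)$; for $x,\theta\in\{0,1\}^n$, $|x\rangle_\theta=\bigotimes_i|x_i\rangle_{\theta_i}$. For $u\subseteq[n]$, $x_u$ is the substring of $x$ indexed by $u$. Trace distance: $D(\rho,\sigma)=\frac12\|\rho-\sigma\|_1$. A family $\mathcal G_n$ of functions $\{0,1\}^n\to\{0,1\}$ is two-universal if $\Pr_{g\in_R\mathcal G_n}[g(x)=g(y)]\le\frac12$ for all $x\ne y$. The syndrome of $v\in\{0,1\}^n$ for a binary linear $[n,k,d]$ code is $Hv\in\{0,1\}^{n-k}$, for a fixed $(n-k)\times n$ parity check matrix $H$ of the code. The ideal functionality $\mathsf{1CC}$: one player inputs a bit $x$, the other player inputs $c\in\{0,1\}$; the first player receives $c$, and the second receives $\bot$ if $c=0$ and $x$ if $c=1$. Protocol $\textsc{commit}^{\mathsf{1CC}}_{N,q,\tau,r}(b)$ between committer Alice (with bit $b$) and receiver Bob. (1) Alice chooses uniformly random $\theta\in\{0,1\}^N$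 and sends the $N$-qubit state $|0^N\rangle_\theta$ to Bob. (2) For $i=1,\dots,N$: Alice and Bob invoke $\mathsf{1CC}$, Alice inputting $\theta_i$ and Bob inputting $1$ with probability $q$ and $0$ with probability $1-q$; if Bob's input was $1$ he measures the $i$th qubit in basis $\theta_i$ and aborts if the result is not $0$. Let $t\subseteq[N]$ be the set of positions checked by Bob, $\bar t=[N]\setminus t$, $n=|\bar t|$. (3) Alice aborts if $|t|>2qN$. (4) Bob chooses a generator matrix $G$ of a binary linear $[n,k,d]$ code with $k/n\ge r$ and $d/n\ge\tau$ and sends $G$ to Alice, who checks that $k/n\ge r$ (aborting otherwise). (5) Alice picks a uniformly random $g$ from a two-universal family $\mathcal G_n$ of functions $\{0,1\}^n\to\{0,1\}$, computes the syndrome $s$ of $\theta_{\bar t}$, and sends $g$, $s$ and $w=g(\theta_{\bar t})\oplus b$ to Bob. A bit-commitment scheme is $\epsilon$-hiding if for any dishonest receiver Bob (computationally unbounded, deviating arbitrarily, with honest Alice), his state $\rho_0$ after a commitment to $b=0$ and his state $\rho_1$ after a commitment to $b=1$ satisfy $D(\rho_0,\rho_1)\le\epsilon$. *)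

(* Defs.v *)
From HB Require Import structures.
From mathcomp Require Import all_boot all_order all_algebra.
From mathcomp Require Import complex.
From mathcomp Require Import reals exp trigo.

Set Implicit Arguments.
Unset Strict Implicit.
Unset Printing Implicit Defensive.
Import Order.TTheory GRing.Theory Num.Theory.
Local Open Scope ring_scope.
Local Open Scope sesquilinear_scope.

(* tr sqrt(A^* A), the sum of the singular values of A. *)
Definition trnorm (C : numClosedFieldType) (d : nat) (A : 'M[C]_d) : C :=
  \sum_(i < d) sqrtC (spectral_diag (A^t* *m A) 0 i).

Definition trdist (C : numClosedFieldType) (d : nat) (rho sigma : 'M[C]_d) : C :=
  2^-1 * trnorm (rho - sigma).

(* A quantum instrument with classical outcome in O: on outcome o the
   (subnormalised) state rho becomes \sum_K K rho K^*, K ranging over kraus o. *)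
Record instrument (C : numClosedFieldType) (O : finType) (d d' : nat) :=
  Instrument {
    kraus : O -> seq 'M[C]_(d', d);
    _ : \sum_(o : O) \sum_(K <- kraus o) K^t* *m K = 1%:M
  }.

Definition measure (C : numClosedFieldType) (O : finType) (d d' : nat)
    (I : instrument C O d d') (o : O) (rho : 'M[C]_d) : 'M[C]_d' :=
  \sum_(K <- kraus I o) K *m rho *m K^t*.

(* receiver : the strategies available to a dishonest receiver;
   rstate B b : the state of dishonest receiver B, including every message
   received, once the honest committer has committed to b. *)
Record commit_scheme (C : numClosedFieldType) := CommitScheme {
  receiver : Type;
  rdim : receiver -> nat;
  rstate : forall B : receiver, bool -> 'M[C]_(rdim B)
}.

Definition hiding (R : realType) (S : commit_scheme R[i]) (eps : R) : Prop :=
  forall B : receiver S,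
    trdist (rstate B false) (rstate B true) <= (eps%:C)%C.

(* The amplitude <y | x>_t of the basis vector |x>_t : computational basis for
   t = false, diagonal basis for t = true. *)
Definition amplitude (C : numClosedFieldType) (x t y : bool) : C :=
  if t then (-1) ^+ (x && y) / sqrtC 2 else (y == x)%:R.

(* |x>_theta; the coordinates of (C^2)^{\otimes N} are indexed by bit strings. *)
Definition ket (C : numClosedFieldType) (N : nat) (x theta : N.-tuple bool) :
    'cV[C]_#|{: N.-tuple bool}| :=
  \col_j \prod_(i < N)
     amplitude C (tnth x i) (tnth theta i) (tnth (enum_val j) i).

(* Outputs of 1CC, first to the player holding x, then to the player choosing
   c; None stands for \bot. *)
Definition oneCC (x c : bool) : bool * option bool :=
  (c, if c then Some x else None).

(* Substring indexed by u. Vectors and matrices over bool use its structure of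
   field with two elements, with exclusive or as addition. *)
Definition substring (N : nat) (x : N.-tuple bool) (u : {set 'I_N}) :
    'cV[bool]_#|u| :=
  \col_j tnth x (enum_val j).

Record hash_family (n : nat) := HashFamily {
  hkey : finType;
  hfun : hkey -> 'cV[bool]_n -> bool;
  _ : (0 < #|hkey|)%N
}.

Definition two_universal (n : nat) (F : hash_family n) : Prop :=
  forall x y : 'cV[bool]_n, x != y ->
    #|[set g : hkey F | hfun g x == hfun g y]|%:R / #|hkey F|%:R
      <= 1 / 2 :> rat.

(* A message announcing a code of length n: a dimension k and a k x n matrix,
   whose rows span the code. *)
Definition code_msg (n : nat) : finType := {k : 'I_n.+1 & 'M[bool]_(k, n)}.

Definition parity_check_choice : Type :=
  forall n k : nat, 'M[bool]_(k, n) -> 'M[bool]_(n - k, n).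

Definition parity_checks (H : parity_check_choice) : Prop :=
  forall (n k : nat) (G : 'M[bool]_(k, n)), row_free G ->
    forall v : 'cV[bool]_n, (v^T <= G)%MS <-> H n k G *m v = 0.

Notation reply := (option bool).

(* The positions checked by Bob; Alice learns them from her outputs of 1CC. *)
Definition checked (N : nat) (h : N.-tuple reply) : {set 'I_N} :=
  [set i | isSome (tnth h i)].

(* Dimension of Bob's memory before the (i+1)st step: the N qubits sent by
   Alice at first, arbitrary afterwards. *)
Definition bob_dim (N : nat) (mem : nat -> nat) (i : nat) : nat :=
  if i is j.+1 then mem j else #|{: N.-tuple bool}|.

(* A dishonest Bob: an input to each invocation of 1CC, then a code, each
   obtained by an arbitrary operation depending on all previous replies. *)
Record dishonest_bob (C : numClosedFieldType) (N : nat) := DishonestBob {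
  mem : nat -> nat;
  ask : forall i : nat, seq reply ->
    instrument C bool (bob_dim N mem i) (bob_dim N mem i.+1);
  announce : forall h : N.-tuple reply,
    instrument C (code_msg #|~: checked h|)
      (bob_dim N mem N) (bob_dim N mem N.+1)
}.

(* Bob's subnormalised state after i invocations of 1CC whose replies to him are
   the first i elements of h, given that Alice's bases are theta. *)
Fixpoint query_state (C : numClosedFieldType) (N : nat) (B : dishonest_bob C N)
    (theta : N.-tuple bool) (h : seq reply) (i : nat) :
    'M[C]_(bob_dim N (mem B) i) :=
  if i is j.+1 then
    let c := isSome (nth None h j) in
    if nth None h j == (oneCC (nth false theta j) c).2
    then measure (ask B j (take j h)) c (query_state B theta h j)
    else 0
  else
    let v := ket C [tuple of nseq N false] theta in v *m v^t*.

(* Bob's classical view after the replies h. None: Alice aborts before a code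
   is announced. Some (m, None): she aborts upon receiving m. Otherwise she
   sends (g, s, w). *)
Definition view_tail (F : forall n, hash_family n) (n : nat) : finType :=
  option {m : code_msg n &
    option (hkey (F n) * 'cV[bool]_(n - tag m) * bool)%type}.

Definition view (F : forall n, hash_family n) (N : nat) : finType :=
  {h : N.-tuple reply & view_tail F #|~: checked h|}.

Definition view_dim (C : numClosedFieldType) (F : forall n, hash_family n)
    (N : nat) (B : dishonest_bob C N) (v : view F N) : nat :=
  bob_dim N (mem B) (if tagged v is Some _ then N.+1 else N).

Definition too_many (R : realType) (N : nat) (q : R) (h : N.-tuple reply) :
    bool :=
  2 * q * N%:R < #|checked h|%:R.

(* Alice accepts generator matrices with k / n >= r. *)
Definition accepts (R : realType) (r : R) (n : nat) (m : code_msg n) : bool :=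
  row_free (tagged m) && (r * n%:R <= (tag m)%:R).

Definition given_bases (R : realType) (N : nat) (q r : R)
    (F : forall n, hash_family n) (H : parity_check_choice)
    (B : dishonest_bob R[i] N) (b : bool) (theta : N.-tuple bool)
    (v : view F N) : 'M[R[i]]_(view_dim B v) :=
  match v return 'M[R[i]]_(view_dim B v) with
  | existT h None =>
      if too_many q h then query_state B theta h N else 0
  | existT h (Some (existT m o)) =>
      let x := substring theta (~: checked h) in
      let rho := measure (announce B h) m (query_state B theta h N) in
      if too_many q h then 0 else
      match o with
      | None => if accepts r m then 0 else rho
      | Some (g, s, w) =>
          if [&& accepts r m, s == H _ _ (tagged m) *m x
               & w == hfun g x (+) b]
          then (#|hkey (F #|~: checked h|)|%:R)^-1 *: rho else 0
      end
  end.

(* The classical view, held in a register of orthogonal states, makes the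
   state block diagonal. *)
Definition bob_state (R : realType) (N : nat) (q r : R)
    (F : forall n, hash_family n) (H : parity_check_choice)
    (B : dishonest_bob R[i] N) (b : bool) :
    'M[R[i]]_(\sum_(j < #|{: view F N}|) view_dim B (enum_val j)) :=
  \mxdiag_(j < #|{: view F N}|)
     ((#|{: N.-tuple bool}|%:R)^-1 *:
        \sum_(theta : N.-tuple bool) given_bases q r H B b theta (enum_val j)).

(* tau only bounds the minimum distance of the code chosen by an honest Bob;
   Alice does not check it. *)
Definition commit_1CC (R : realType) (N : nat) (q tau r : R)
    (F : forall n, hash_family n) (H : parity_check_choice) :
    commit_scheme R[i] :=
  @CommitScheme R[i] (dishonest_bob R[i] N)
    (fun B => \sum_(j < #|{: view F N}|) view_dim B (enum_val j))%N
    (fun B b => bob_state q r F H B b).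

Definition log2 (R : realType) (x : R) : R := ln x / ln 2.

(* Main.v *)
Require Import Defs.
From HB Require Import structures.
From mathcomp Require Import all_boot all_order all_algebra.
From mathcomp Require Import complex.
From mathcomp Require Import reals exp trigo.
From mathcomp Require Import ring lra.
Set Implicit Arguments.
Unset Strict Implicit.
Unset Printing Implicit Defensive.
Import Order.TTheory GRing.Theory Num.Theory.
Local Open Scope ring_scope.
Local Open Scope sesquilinear_scope.

(* Averaged over Alice's bases, 2^-N |0>_theta<0|_theta is dominated by one
   operator of trace gamma^N, the N-fold tensor power of the optimal dual
   solution for guessing a single basis bit.  Whatever Bob does is completely
   positive, so after classical messages m his unnormalised state T_theta stays
   below the image Sg of that operator.  A basis revealed by 1CC doubles the
   total trace of the images Sg, since the answer is weighted 1/2 in a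
   normalised average, and summing over syndromes multiplies it by 2^(n-k);
   Alice's checks bound the product by K = 2^(2qN) 2^((1-r)N) gamma^N.
   The states for b = 0 and b = 1 differ by the sum of +-T_theta with signs
   (-1)^g(x).  Conjugating by Sg^(-1/4), applying Cauchy-Schwarz and averaging
   over g, the terms with distinct theta are at most 0, so the trace norm is
   bounded by sqrt(tr Sg * sum_theta tr T_theta).  The geometric mean is used in
   the form 1/2 (c tr Sg + c^-1 sum tr T_theta) with a common c, which sums
   linearly over all messages to 1/2 (c K + c^-1); c = K^(-1/2) gives sqrt K. *)

(** * Positive matrices, contractions and the trace norm *)

Section Psd.
Variable C : numClosedFieldType.

Lemma adjmxM m n p (A : 'M[C]_(m, n)) (B : 'M[C]_(n, p)) :
  (A *m B)^t* = B^t* *m A^t*.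
Proof. by rewrite trmx_mul map_mxM. Qed.

Lemma adjmxB m n (A B : 'M[C]_(m, n)) : (A - B)^t* = A^t* - B^t*.
Proof. by rewrite linearB /= map_mxB. Qed.

Lemma adjmxZ m n a (A : 'M[C]_(m, n)) : (a *: A)^t* = a^* *: A^t*.
Proof. by apply/matrixP => i j; rewrite !mxE rmorphM. Qed.

Lemma adjmx1 n : (1%:M : 'M[C]_n)^t* = 1%:M.
Proof. by rewrite trmx1 map_mx1. Qed.

Lemma adjmx_diag_ge0 n (a : 'rV[C]_n) : (forall i, 0 <= a 0 i) ->
  (diag_mx a)^t* = diag_mx a.
Proof.
move=> a0; apply/matrixP => i j; rewrite !mxE rmorphMn /= eq_sym.
by have [->|//] := eqVneq i j; rewrite geC0_conj.
Qed.

Lemma mxtrace_adj_mul m n (B : 'M[C]_(m, n)) :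
  \tr (B^t* *m B) = \sum_i \sum_j `|B j i| ^+ 2.
Proof.
apply: eq_bigr => i _; rewrite mxE; apply: eq_bigr => j _.
by rewrite !mxE mulrC normCK.
Qed.

Lemma mxtrace_adj_eq0 m n (B : 'M[C]_(m, n)) : \tr (B^t* *m B) = 0 -> B = 0.
Proof.
rewrite mxtrace_adj_mul => /eqP; rewrite psumr_eq0; last first.
  by move=> i _; apply: sumr_ge0 => j _; rewrite exprn_ge0.
move=> /allP B0; apply/matrixP => j i; rewrite mxE.
have /= := B0 i (mem_index_enum _); rewrite psumr_eq0; last first.
  by move=> k _; rewrite exprn_ge0.
move=> /allP /(_ j (mem_index_enum _)).
by rewrite /= expf_eq0 normr_eq0 => /eqP.
Qed.

(** Positivity is taken in Gram form with an arbitrary inner dimension, so that sums amount to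
    stacking factors and conjugations to multiplying them. *)
Definition psd n (A : 'M[C]_n) : Prop :=
  exists m, exists B : 'M[C]_(m, n), A = B^t* *m B.

Lemma psd_gram m n (B : 'M[C]_(m, n)) : psd (B^t* *m B).
Proof. by exists m, B. Qed.

Lemma psd0 n : psd (0 : 'M[C]_n).
Proof. by exists 0, 0; rewrite mulmx0. Qed.

Lemma psdD n (A B : 'M[C]_n) : psd A -> psd B -> psd (A + B).
Proof.
move=> [m [E ->]] [p [F ->]]; exists (m + p)%N, (col_mx E F).
by rewrite tr_col_mx map_row_mx mul_row_col.
Qed.

Lemma psd_sum (I : Type) (s : seq I) (P : pred I) n (A : I -> 'M[C]_n) :
  (forall i, P i -> psd (A i)) -> psd (\sum_(i <- s | P i) A i).
Proof. by move=> pA; apply: big_ind => //; [exact: psd0|exact: psdD]. Qed.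

Lemma psd_conj m n (K : 'M[C]_(m, n)) (A : 'M[C]_n) :
  psd A -> psd (K *m A *m K^t*).
Proof.
by move=> [p [E ->]]; exists p, (E *m K^t*); rewrite adjmxM trmxCK !mulmxA.
Qed.

Lemma psdZ n (a : C) (A : 'M[C]_n) : 0 <= a -> psd A -> psd (a *: A).
Proof.
move=> a0 [m [B ->]]; exists m, (sqrtC a *: B).
rewrite adjmxZ -scalemxAl -scalemxAr scalerA.
by rewrite (@geC0_conj _ (sqrtC a)) ?sqrtC_ge0// -expr2 sqrtCK.
Qed.

Lemma psd_herm n (A : 'M[C]_n) : psd A -> A^t* = A.
Proof. by move=> [m [B ->]]; rewrite adjmxM trmxCK. Qed.

Lemma psd_tr_ge0 n (A : 'M[C]_n) : psd A -> 0 <= \tr A.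
Proof.
move=> [m [B ->]]; rewrite mxtrace_adj_mul.
by apply: sumr_ge0 => i _; apply: sumr_ge0 => j _; rewrite exprn_ge0.
Qed.

Lemma psd_mul_tr_ge0 n (A B : 'M[C]_n) : psd A -> psd B -> 0 <= \tr (A *m B).
Proof.
move=> [m [E ->]] pB.
by rewrite -mulmxA mxtrace_mulC; apply/psd_tr_ge0/psd_conj.
Qed.

Lemma psd_diag_ge0 n (A : 'M[C]_n) i : psd A -> 0 <= A i i.
Proof.
move=> [m [B ->]]; rewrite mxE; apply: sumr_ge0 => j _.
by rewrite !mxE mulrC -normCK exprn_ge0.
Qed.

Lemma psd_diag_mx n (a : 'rV[C]_n) : (forall i, 0 <= a 0 i) -> psd (diag_mx a).
Proof.
move=> a0; exists n, (diag_mx (\row_i sqrtC (a 0 i))).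
rewrite adjmx_diag_ge0 => [|i]; last by rewrite mxE sqrtC_ge0.
rewrite mulmx_diag; congr diag_mx; apply/rowP => i.
by rewrite !mxE -expr2 sqrtCK.
Qed.

Lemma psd_spectral n (A : 'M[C]_n) : psd A ->
  exists U : 'M[C]_n, [/\ U^t* *m U = 1%:M, U *m U^t* = 1%:M,
    A = U^t* *m diag_mx (spectral_diag A) *m U
    & forall i, 0 <= spectral_diag A 0 i].
Proof.
move=> pA; have hU := spectral_unitarymx A.
set U := spectralmx A in hU *; set a := spectral_diag A.
have UU : U *m U^t* = 1%:M by apply/unitarymxP.
have VU : U^t* *m U = 1%:M by apply: mulmx1C.
have nA : A \is normalmx by apply/normalmxP; rewrite psd_herm.
have dA : A = U^t* *m diag_mx a *m U.
  by have /orthomx_spectralP := nA; rewrite -/U invmx_unitary.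
exists U; split => // i.
have : diag_mx a = U *m A *m U^t*.
  by rewrite dA !mulmxA UU mul1mx -mulmxA UU mulmx1.
move=> /(congr1 (fun M : 'M[C]_n => M i i)); rewrite mxE eqxx mulr1n => ->.
exact/psd_diag_ge0/psd_conj.
Qed.

(** Carrying both conditions makes the notion symmetric under adjoints and yields the bounds on rows
    and on columns directly from diagonal entries. *)
Definition contraction m n (S : 'M[C]_(m, n)) : Prop :=
  psd (1%:M - S *m S^t*) /\ psd (1%:M - S^t* *m S).

Lemma psd_proj_compl n (P : 'M[C]_n) :
  P^t* = P -> P *m P = P -> psd (1%:M - P).
Proof.
move=> hP PP; exists n, (1%:M - P).
by rewrite adjmxB adjmx1 hP mulmxBl mul1mx mulmxBr mulmx1 PP subrr subr0.
Qed.

(** Both [W^t* *m W] and [W *m W^t*] are projections, whose complements are positive. *)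
Lemma contraction_partial_isometry m n (W : 'M[C]_(m, n)) (P : 'M[C]_n) :
  P^t* = P -> P *m P = P -> W^t* *m W = P -> W *m P = W -> contraction W.
Proof.
move=> hP PP WP WPW; split; apply: psd_proj_compl; rewrite ?WP//.
  by rewrite adjmxM trmxCK.
by rewrite mulmxA -[X in X *m _]mulmxA WP WPW.
Qed.

Lemma contraction_adj m n (S : 'M[C]_(m, n)) :
  contraction S -> contraction (S^t*).
Proof. by move=> [? ?]; split; rewrite trmxCK. Qed.

Lemma contraction_isometry m n (W : 'M[C]_(m, n)) :
  W^t* *m W = 1%:M -> contraction W.
Proof.
by move=> W1; apply: (contraction_partial_isometry (adjmx1 _)); rewrite ?mulmx1.
Qed.

Lemma contraction_mul m n p (S : 'M[C]_(m, n)) (T : 'M[C]_(n, p)) :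
  contraction S -> contraction T -> contraction (S *m T).
Proof.
move=> [S1 S2] [T1 T2]; split; rewrite adjmxM.
  have -> : 1%:M - S *m T *m (T^t* *m S^t*)
    = (1%:M - S *m S^t*) + S *m (1%:M - T *m T^t*) *m S^t*.
    by rewrite mulmxBr mulmxBl mulmx1 !mulmxA addrA subrK.
  by apply: psdD => //; exact: psd_conj.
have -> : 1%:M - T^t* *m S^t* *m (S *m T)
    = (1%:M - T^t* *m T) + T^t* *m (1%:M - S^t* *m S) *m (T^t*)^t*.
  by rewrite trmxCK mulmxBr mulmxBl mulmx1 !mulmxA addrA subrK.
by apply: psdD => //; exact: psd_conj.
Qed.

(** The submatrix is the compression [E *m S *m E^t*], where [E^t*] is an isometry. This serves for
    the diagonal blocks of a contraction. *)
Lemma contraction_mxsub m n (f : 'I_m -> 'I_n) (S : 'M[C]_n) :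
  injective f -> contraction S -> contraction (mxsub f f S).
Proof.
move=> inj_f hS.
pose E : 'M[C]_(m, n) := rowsub f 1%:M.
have hE : contraction (E^t*).
  apply: contraction_isometry; rewrite trmxCK.
  apply/matrixP => i j; rewrite !mxE (bigD1 (f i))//= big1 ?addr0 => [|k ki].
    by rewrite !mxE eqxx mul1r (inj_eq inj_f) eq_sym conjC_nat.
  by rewrite !mxE eq_sym (negPf ki) mul0r.
suff -> : mxsub f f S = E *m S *m E^t*.
  apply: (contraction_mul _ hE); apply: contraction_mul => //.
  by rewrite -[E]trmxCK; exact: (contraction_adj hE).
rewrite mul_rowsub_mx mul1mx.
apply/matrixP => i j; rewrite !mxE (bigD1 (f j))//= big1 ?addr0 => [|k kj].
  by rewrite !mxE eqxx conjC1 mulr1.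
by rewrite !mxE eq_sym (negPf kj) conjC0 mulr0.
Qed.

Lemma trnorm_ge0 n (A : 'M[C]_n) : 0 <= trnorm A.
Proof.
have [U [_ _ _ a0]] := psd_spectral (psd_gram A).
by apply: sumr_ge0 => i _; rewrite sqrtC_ge0.
Qed.

(** Polar decomposition: [A] is [W] times the diagonal matrix of singular values times [U], with [W]
    a partial isometry; [U^t* *m W^t*] attains the norm. *)
Lemma trnorm_polar n (A : 'M[C]_n) :
  exists2 S : 'M[C]_n, contraction S & trnorm A = \tr (S *m A).
Proof.
have [U [VU UV dA a0]] := psd_spectral (psd_gram A).
rewrite /trnorm; set a := spectral_diag _ in dA a0 *.
pose B := A *m U^t*.
have BB : B^t* *m B = diag_mx a.
  rewrite /B adjmxM trmxCK -mulmxA [A^t* *m _]mulmxA dA !mulmxA UV mul1mx.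
  by rewrite -mulmxA UV mulmx1.
(* Since [0^-1 = 0], [diag_mx d] is the pseudo-inverse of the matrix of singular values; [diag_mx p]
   below projects onto their support. *)
pose d : 'rV[C]_n := \row_i (sqrtC (a 0 i))^-1.
have hd : (diag_mx d)^t* = diag_mx d.
  by apply: adjmx_diag_ge0 => i; rewrite mxE invr_ge0 sqrtC_ge0.
pose p : 'rV[C]_n := \row_i (a 0 i != 0)%:R.
have hp : (diag_mx p)^t* = diag_mx p.
  by apply: adjmx_diag_ge0 => i; rewrite mxE ler0n.
pose W := B *m diag_mx d.
have sq i : sqrtC (a 0 i) * sqrtC (a 0 i) = a 0 i by rewrite -expr2 sqrtCK.
have hW : contraction W.
  apply: (contraction_partial_isometry hp).
  - rewrite mulmx_diag; congr diag_mx; apply/rowP => i.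
    by rewrite !mxE; case: eqP; rewrite !(mulr0, mulr1).
  - rewrite /W adjmxM hd -mulmxA [B^t* *m _]mulmxA BB !mulmx_diag.
    congr diag_mx; apply/rowP => i; rewrite !mxE.
    have [->|nz] := eqVneq (a 0 i) 0; first by rewrite !(mul0r, mulr0).
    by rewrite -{2}sq mulfK ?sqrtC_eq0// mulVf ?sqrtC_eq0.
  - rewrite /W -mulmxA mulmx_diag; congr (_ *m diag_mx _); apply/rowP => i.
    rewrite !mxE; have [->|] := eqVneq (a 0 i) 0; last by rewrite mulr1.
    by rewrite sqrtC0 invr0 mul0r.
have hU : contraction U by exact: contraction_isometry.
have UW : contraction (U^t* *m W^t*).
  by apply: contraction_mul; exact: contraction_adj.
exists (U^t* *m W^t*) => //.
rewrite -mulmxA mxtrace_mulC -mulmxA /W adjmxM hd -mulmxA -/B BB mulmx_diag.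
rewrite mxtrace_diag; apply: eq_bigr => i _; rewrite !mxE.
have [->|nz] := eqVneq (a 0 i) 0; first by rewrite sqrtC0 mulr0.
by rewrite -{3}sq mulKf ?sqrtC_eq0.
Qed.

End Psd.

(** * Hashing against quantum side information *)

Section Hashing.
Variable C : numClosedFieldType.

Lemma contraction_row_le1 n (S : 'M[C]_n) i :
  contraction S -> \sum_j `|S i j| ^+ 2 <= 1.
Proof.
move=> [/(psd_diag_ge0 i) + _]; rewrite !mxE eqxx mulr1n subr_ge0.
by apply: le_trans; apply: ler_sum => j _; rewrite !mxE normCK.
Qed.

Lemma contraction_col_le1 n (S : 'M[C]_n) j :
  contraction S -> \sum_i `|S i j| ^+ 2 <= 1.
Proof.
move=> [_ /(psd_diag_ge0 j)]; rewrite !mxE eqxx mulr1n subr_ge0.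
by apply: le_trans; apply: ler_sum => i _; rewrite !mxE mulrC normCK.
Qed.

Lemma amgm2 (x y c : C) : 0 <= x -> 0 <= y -> 0 < c ->
  x * y <= 2^-1 * (c * x ^+ 2 + c^-1 * y ^+ 2).
Proof.
move=> x0 y0 c0; rewrite -subr_ge0.
have -> : 2^-1 * (c * x ^+ 2 + c^-1 * y ^+ 2) - x * y
  = 2^-1 * c^-1 * (c * x - y) ^+ 2 by field; rewrite (gt_eqF c0).
have cr : c * x - y \is Num.real.
  by rewrite rpredB// ger0_real// mulr_ge0// ltW.
by rewrite mulr_ge0 ?real_exprn_even_ge0// mulr_ge0// invr_ge0 ltW.
Qed.

(** With [f i] the fourth root of [a 0 i], each product of entries of [S] and [A] is split into [S]
    times [f i * f j] and [A] divided by it, and [amgm2] is applied. The support condition covers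
    the zero eigenvalues. *)
Lemma diag_trace_bound n (a : 'rV[C]_n) (S A : 'M[C]_n) (c : C)
    (d : 'rV[C]_n := \row_i (sqrtC (sqrtC (a 0 i)))^-1 ^+ 2) :
  (forall i, 0 <= a 0 i) ->
  (forall i j, A i j != 0 -> (a 0 i != 0) && (a 0 j != 0)) ->
  contraction S -> 0 < c ->
  `|\tr (S *m A)| <= 2^-1 * (c * \sum_i a 0 i +
     c^-1 * \tr (diag_mx d *m A *m diag_mx d *m A^t*)).
Proof.
move=> a0 suppA hS c0.
pose f i := sqrtC (sqrtC (a 0 i)).
have f0 i : 0 <= f i by rewrite !sqrtC_ge0.
have f4 i : f i ^+ 2 ^+ 2 = a 0 i by rewrite !sqrtCK.
have -> : \tr (diag_mx d *m A *m diag_mx d *m A^t*)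
    = \sum_i \sum_j (`|A i j| * ((f i)^-1 * (f j)^-1)) ^+ 2.
  apply: eq_bigr => i _; rewrite mxE; apply: eq_bigr => j _.
  rewrite -mulmxA mul_diag_mx mul_mx_diag !mxE exprMn normCK.
  by rewrite /d -/(f i) -/(f j); ring.
rewrite /mxtrace; under eq_bigr do rewrite mxE.
apply: (@le_trans _ _ (\sum_i \sum_j
    2^-1 * (c * (`|S i j| * (f i * f j)) ^+ 2 +
     c^-1 * (`|A j i| * ((f i)^-1 * (f j)^-1)) ^+ 2))).
  rewrite (le_trans (ler_norm_sum _ _ _))// ler_sum// => i _.
  rewrite (le_trans (ler_norm_sum _ _ _))// ler_sum// => j _.
  rewrite normrM; have [->|nz] := eqVneq (A j i) 0.
    rewrite normr0 mulr0 mul0r expr0n /= mulr0 addr0.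
    by rewrite mulr_ge0 ?invr_ge0// mulr_ge0 ?exprn_ge0// ?mulr_ge0// ltW.
  have /andP[aj ai] := suppA _ _ nz.
  have fi : f i != 0 by rewrite !sqrtC_eq0.
  have fj : f j != 0 by rewrite !sqrtC_eq0.
  have -> : `|S i j| * `|A j i|
    = (`|S i j| * (f i * f j)) * (`|A j i| * ((f i)^-1 * (f j)^-1)).
    by field; rewrite fi fj.
  by apply: amgm2; rewrite ?mulr_ge0// ?invr_ge0.
under eq_bigr do rewrite -mulr_sumr big_split /= -!mulr_sumr.
rewrite -mulr_sumr big_split /= -!mulr_sumr ler_pM2l ?invr_gt0 ?ltr0n//.
rewrite lerD//; last first.
  rewrite [X in _ <= _ * X]exchange_big /= ler_pM2l ?invr_gt0//.
  by apply: ler_sum => i _; apply: ler_sum => j _; rewrite [(f j)^-1 * _]mulrC.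
rewrite ler_pM2l//.
(* Here [f i ^+ 2 * f j ^+ 2] is at most the mean of [a 0 i] and [a 0 j]; the row and column sums of
   squares of [S] are then at most 1. *)
apply: (@le_trans _ _ (\sum_i \sum_j
    2^-1 * (`|S i j| ^+ 2 * a 0 i + `|S i j| ^+ 2 * a 0 j))).
  apply: ler_sum => i _; apply: ler_sum => j _.
  rewrite exprMn -mulrDr [leRHS]mulrCA ler_wpM2l ?exprn_ge0// exprMn.
  have := @amgm2 (f i ^+ 2) (f j ^+ 2) 1; rewrite invr1 !mul1r !f4.
  by apply; rewrite ?exprn_ge0.
have -> : \sum_i \sum_j 2^-1 * (`|S i j| ^+ 2 * a 0 i + `|S i j| ^+ 2 * a 0 j)
  = 2^-1 * (\sum_i (\sum_j `|S i j| ^+ 2) * a 0 i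
          + \sum_j (\sum_i `|S i j| ^+ 2) * a 0 j).
  have -> : \sum_j (\sum_i `|S i j| ^+ 2) * a 0 j
    = \sum_i \sum_j `|S i j| ^+ 2 * a 0 j.
    by rewrite exchange_big; apply: eq_bigr => j _; rewrite mulr_suml.
  rewrite -big_split mulr_sumr; apply: eq_bigr => i _.
  by rewrite -mulr_sumr mulr_suml -big_split.
have -> : \sum_i a 0 i = 2^-1 * (\sum_i a 0 i + \sum_i a 0 i) by field.
by rewrite ler_pM2l ?invr_gt0// lerD// ler_sum// => i _; rewrite ler_piMl//
  ?contraction_row_le1 ?contraction_col_le1.
Qed.

(* [W] is the inverse square root of [Sg] on the range of [Sg] and [0] on its
   kernel, [Q] the projection onto that range. *)
Lemma inv_sqrt_trace_bound n (Sg : 'M[C]_n) : psd Sg ->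
  exists W Q : 'M[C]_n, [/\ psd W,
    forall T, psd T -> psd (Sg - T) ->
      Q *m T *m Q = T /\ \tr (W *m T *m W *m T) <= \tr T &
    forall S A c, contraction S -> Q *m A *m Q = A -> 0 < c ->
      `|\tr (S *m A)| <=
        2^-1 * (c * \tr Sg + c^-1 * \tr (W *m A *m W *m A^t*))].
Proof.
move=> pS; have [U [VU UV dS a0]] := psd_spectral pS.
set a := spectral_diag Sg in dS a0.
pose d : 'rV[C]_n := \row_i (sqrtC (sqrtC (a 0 i)))^-1 ^+ 2.
pose p : 'rV[C]_n := \row_i (a 0 i != 0)%:R.
have d0 i : 0 <= d 0 i by rewrite mxE exprn_ge0// invr_ge0 !sqrtC_ge0.
have p0 i : 0 <= p 0 i by rewrite mxE ler0n.
have hd := adjmx_diag_ge0 d0.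
have hp := adjmx_diag_ge0 p0.
have pp : diag_mx p *m diag_mx p = diag_mx p.
  rewrite mulmx_diag; congr diag_mx; apply/rowP => i.
  by rewrite !mxE; case: eqP; rewrite !(mulr0, mulr1).
have dad : diag_mx d *m diag_mx a *m diag_mx d = diag_mx p.
  rewrite !mulmx_diag; congr diag_mx; apply/rowP => i; rewrite !mxE.
  rewrite exprVn sqrtCK.
  have [->|nz] := eqVneq (a 0 i) 0; first by rewrite mulr0 mul0r.
  by rewrite mulrAC -expr2 exprVn sqrtCK mulVf.
have UK (M N : 'M[C]_n) : (U^t* *m M *m U) *m (U^t* *m N *m U)
    = U^t* *m (M *m N) *m U.
  by rewrite !mulmxA -[_ *m U *m U^t*]mulmxA UV mulmx1.
pose W := U^t* *m diag_mx d *m U; pose Q := U^t* *m diag_mx p *m U.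
have hW : W^t* = W by rewrite /W !adjmxM trmxCK hd mulmxA.
have hQ : Q^t* = Q by rewrite /Q !adjmxM trmxCK hp mulmxA.
have QQ : Q *m Q = Q by rewrite UK pp.
have SQ : Sg *m Q = Sg.
  rewrite dS UK mulmx_diag; congr (_ *m diag_mx _ *m _); apply/rowP => i.
  by rewrite !mxE; case: eqP => [->|_]; rewrite ?mul0r ?mulr1.
have WSW : W *m Sg *m W = Q by rewrite [in LHS]dS !UK dad.
have pW : psd W.
  by rewrite /W -[X in _ *m X]trmxCK; apply/psd_conj/psd_diag_mx.
exists W, Q; split=> // [T pT pST|S A c hS QAQ c0].
  split.
    have [m [B dT]] := pT.
    suff BQ : B *m Q = B.
      have -> : Q *m T *m Q = (B *m Q)^t* *m (B *m Q).
        by rewrite adjmxM hQ dT !mulmxA.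
      by rewrite BQ.
    apply/eqP; rewrite -subr_eq0; apply/eqP.
    (* [Sg] vanishes on the range of [K], where [Sg - T] therefore reduces to [- T]; positivity
       forces the trace of [K *m T *m K] to be at most 0. *)
    have : \tr ((B *m Q - B)^t* *m (B *m Q - B)) <= 0.
      pose K := 1%:M - Q.
      have hK : K^t* = K by rewrite adjmxB adjmx1 hQ.
      have -> : B *m Q - B = - (B *m K) by rewrite mulmxBr mulmx1 opprB.
      have -> : (- (B *m K))^t* *m - (B *m K) = K *m T *m K^t*.
        have -> : (- (B *m K))^t* = - (B *m K)^t*.
          by apply/matrixP => i j; rewrite !mxE rmorphN.
        by rewrite mulmxN mulNmx opprK adjmxM hK dT !mulmxA.
      rewrite -subr_ge0 sub0r -linearN /=.
      suff -> : - (K *m T *m K^t*) = K *m (Sg - T) *m K^t*.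
        by apply/psd_tr_ge0/psd_conj.
      have SK : Sg *m K = 0 by rewrite mulmxBr mulmx1 SQ subrr.
      rewrite (mulmxBr K Sg) (mulmxBl (K *m Sg)) hK.
      by rewrite -(mulmxA K Sg) SK mulmx0 sub0r.
    move=> le0; apply: mxtrace_adj_eq0; apply/eqP.
    by rewrite eq_le le0 psd_tr_ge0//; exact: psd_gram.
  (* The difference of traces is the trace of [(1 - W T W) T]. Conjugating [Sg - T] by [W] turns
     [Sg] into [Q], which shows [1 - W T W] positive. *)
  rewrite -subr_ge0 -[W *m T *m W *m T]/((W *m T *m W) *m T) -linearB /=.
  rewrite -{1}[T]mul1mx -mulmxBl; apply: psd_mul_tr_ge0 => //.
  have -> : 1%:M - W *m T *m W = (1%:M - Q) + W *m (Sg - T) *m W^t*.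
    by rewrite hW mulmxBr mulmxBl WSW addrA subrK.
  by apply: psdD; [exact: psd_proj_compl|exact: psd_conj].
(* In the eigenbasis of [Sg] the operator [W] is diagonal, and [diag_trace_bound] applies. *)
pose S' := U *m S *m U^t*; pose A' := U *m A *m U^t*.
have dA : A = U^t* *m A' *m U.
  by rewrite /A' !mulmxA VU mul1mx -mulmxA VU mulmx1.
have trU (M : 'M[C]_n) : \tr (U^t* *m M *m U) = \tr M.
  by rewrite mxtrace_mulC mulmxA UV mul1mx.
have dSt : S = U^t* *m S' *m U.
  by rewrite /S' !mulmxA VU mul1mx -mulmxA VU mulmx1.
have -> : \tr (S *m A) = \tr (S' *m A') by rewrite dSt dA UK trU.
have -> : \tr Sg = \sum_i a 0 i by rewrite dS trU mxtrace_diag.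
have -> : W *m A *m W *m A^t*
    = U^t* *m (diag_mx d *m A' *m diag_mx d *m A'^t*) *m U.
  have -> : A^t* = U^t* *m A'^t* *m U by rewrite dA !adjmxM trmxCK mulmxA.
  by rewrite dA !UK.
have hU : contraction U by exact: contraction_isometry.
have hS' : contraction S'.
  by do 2?[apply: contraction_mul => //]; exact: contraction_adj.
rewrite trU; apply: diag_trace_bound => //.
move=> i j; have -> : A' = diag_mx p *m A' *m diag_mx p.
  transitivity (U *m (Q *m A *m Q) *m U^t*); first by rewrite QAQ.
  by rewrite dA /Q !UK !mulmxA UV mul1mx -mulmxA UV mulmx1.
rewrite mul_diag_mx mul_mx_diag !mxE.
by case: (a 0 i == 0); case: (a 0 j == 0); rewrite /= ?mul0r ?mulr0 ?eqxx.
Qed.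

(* Expanding [tr (W A W A)], the terms with [x <> y] average to at most zero over
   the hash key because [tr (W T_x W T_y) >= 0]. *)
Lemma hashed_trace_bound n (G X : finType) (e : G -> X -> bool) (P : pred X)
    (S : G -> 'M[C]_n) (Sg : 'M[C]_n) (T : X -> 'M[C]_n) (c : C) :
  (forall x y, P x -> P y -> x != y ->
    \sum_g (-1) ^+ e g x * (-1) ^+ e g y <= 0 :> C) ->
  (forall g, contraction (S g)) -> psd Sg ->
  (forall x, P x -> psd (T x)) -> (forall x, P x -> psd (Sg - T x)) -> 0 < c ->
  \sum_g `|\tr (S g *m \sum_(x | P x) (-1) ^+ e g x *: T x)|
   <= #|G|%:R * (2^-1 * (c * \tr Sg + c^-1 * \sum_(x | P x) \tr (T x))).
Proof.
move=> he hS pS pT pST c0.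
have [W [Q [pW hT hA]]] := inv_sqrt_trace_bound pS.
pose A g := \sum_(x | P x) (-1) ^+ e g x *: T x.
have hAg g : (A g)^t* = A g.
  rewrite /A linear_sum map_mx_sum; apply: eq_bigr => x Px.
  by rewrite adjmxZ rmorph_sign psd_herm//; apply: pT.
have QA g : Q *m A g *m Q = A g.
  rewrite /A mulmx_sumr mulmx_suml; apply: eq_bigr => x Px.
  by rewrite -scalemxAr -scalemxAl (hT _ (pT x Px) (pST x Px)).1.
apply: le_trans (_ : \sum_g 2^-1 * (c * \tr Sg +
    c^-1 * \tr (W *m A g *m W *m A g)) <= _).
  apply: ler_sum => g _; have := hA _ _ _ (hS g) (QA g) c0.
  by rewrite hAg.
rewrite -mulr_sumr big_split sumr_const -mulr_sumr [leRHS]mulrCA.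
rewrite ler_pM2l ?invr_gt0 ?ltr0n// mulrDr -(mulr_natl (c * \tr Sg)) lerD//.
rewrite [leRHS]mulrCA ler_pM2l ?invr_gt0//.
pose B x y := \tr (W *m T x *m W *m T y).
have -> : \sum_g \tr (W *m A g *m W *m A g) =
    \sum_(x | P x) \sum_(y | P y)
      (\sum_g (-1) ^+ e g x * (-1) ^+ e g y) * B x y.
  rewrite [RHS](eq_bigr (fun x => \sum_g \sum_(y | P y)
     (-1) ^+ e g x * (-1) ^+ e g y * B x y)); last first.
    move=> x Px; rewrite exchange_big /=; apply: eq_bigr => y Py.
    by rewrite mulr_suml.
  rewrite [RHS]exchange_big; apply: eq_bigr => g _ /=.
  have -> : W *m A g *m W = \sum_(x | P x) (-1) ^+ e g x *: (W *m T x *m W).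
    rewrite mulmx_sumr mulmx_suml; apply: eq_bigr => x _.
    by rewrite -scalemxAr -scalemxAl.
  rewrite mulmx_suml linear_sum; apply: eq_bigr => x _.
  rewrite -scalemxAl mulmx_sumr scaler_sumr linear_sum; apply: eq_bigr => y _.
  by rewrite -scalemxAr !linearZ /= mulrA.
rewrite mulr_sumr; apply: ler_sum => x Px.
(* In the term [y = x] the signs square to 1, and the bound by [\tr (T x)] is the one from
   [inv_sqrt_trace_bound]. *)
rewrite (bigD1 x)//= -[leRHS]addr0 lerD//.
  under eq_bigr do rewrite -expr2 sqrr_sign.
  rewrite sumr_const ler_wpM2l ?ler0n//.
  exact: (hT _ (pT x Px) (pST x Px)).2.
apply: sumr_le0 => y /andP[Py yx]; rewrite mulr_le0_ge0//.
  by apply: he; rewrite // eq_sym.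
rewrite /B; apply: psd_mul_tr_ge0; last exact: pT.
by rewrite -{2}(psd_herm pW); apply/psd_conj/pT.
Qed.

End Hashing.

(** * Guessing the bases *)

Section Guessing.
Variable C : numClosedFieldType.
Local Notation s2 := (sqrtC 2 : C).

Lemma sum_enum_val (T : finType) (F : T -> C) :
  \sum_(j < #|{: T}|) F (enum_val j) = \sum_x F x.
Proof.
by rewrite [RHS](reindex (@enum_val T {: T}))//; exact/onW_bij/enum_val_bij.
Qed.

Lemma sum_tuple_prod (N : nat) (T : finType) (F : 'I_N -> T -> C) :
  \sum_(x : N.-tuple T) \prod_i F i (tnth x i) = \prod_i \sum_y F i y.
Proof.
rewrite bigA_distr_bigA /=.
rewrite (reindex (fun f : {ffun 'I_N -> T} => [tuple f i | i < N])) /=.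
  by apply: eq_bigr => f _; apply: eq_bigr => i _; rewrite tnth_mktuple.
exists (fun x : N.-tuple T => [ffun i => tnth x i]) => x _.
  by apply/ffunP => i; rewrite ffunE tnth_mktuple.
by apply: eq_from_tnth => i; rewrite tnth_mktuple ffunE.
Qed.

(* The optimal solution of the dual of the semidefinite program for guessing
   one basis bit from its qubit: it dominates 1/2 |0><0|_t for both bases t, and
   its trace (2 + sqrt 2) / 4 = cos^2 (pi / 8) is the guessing probability. *)
Definition guess_entry (y z : bool) : C :=
  (if y == z then (if y then 1 + s2 else 3 + s2) else 1) / 8.

(* [guess_factor t true] spans the difference between the operator above and
   1/2 |0><0|_t, which has rank one. *)
Definition guess_factor (t e y : bool) : C :=
  if e then
    (-1) ^+ (t && y) * sqrtC (s2 + (if t == y then - 1 else 1)) / sqrtC 8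
  else amplitude C false t y / s2.

Lemma s2_gt1 : 1 < s2.
Proof. by rewrite -[ltLHS]sqrtC1 ltr_sqrtC ?nnegrE ?ler01 ?ler0n// ltr1n. Qed.

(** The left side is free of [t], so one operator serves both bases: [e = false] contributes the
    state 1/2 |0><0|_t and [e = true] the rank-one remainder. *)
Lemma guess_entryE (t y z : bool) :
  guess_entry y z =
  \sum_(e : bool) guess_factor t e y * (guess_factor t e z)^*.
Proof.
have s0 : 0 < s2 by rewrite sqrtC_gt0 ltr0n.
have ss : s2 * s2 = 2 by rewrite -expr2 sqrtCK.
have s80 : 0 < sqrtC 8 :> C by rewrite sqrtC_gt0 ltr0n.
have s88 : sqrtC 8 * sqrtC 8 = 8 :> C by rewrite -expr2 sqrtCK.
have a0 : 0 <= s2 - 1 by rewrite subr_ge0 ltW ?s2_gt1.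
have b0 : 0 <= s2 + 1 by rewrite addr_ge0// ltW.
set a := sqrtC (s2 - 1); set b := sqrtC (s2 + 1).
have aa : a * a = s2 - 1 by rewrite -expr2 sqrtCK.
have bb : b * b = s2 + 1 by rewrite -expr2 sqrtCK.
(* The product of [s2 - 1] and [s2 + 1] is 1; this gives the off-diagonal entries of the
   remainder. *)
have ab : a * b = 1.
  rewrite /a /b -rootCMl// -[RHS]sqrtC1; congr sqrtC.
  by rewrite mulrDr mulrBl ss; ring.
have i8 x u : x / sqrtC 8 * (u / sqrtC 8) = x * u / 8 :> C.
  by rewrite mulrACA -invfM s88.
have i2 x u : x / s2 * (u / s2) = x * u / 2 by rewrite mulrACA -invfM ss.
have -> : \sum_(e : bool) guess_factor t e y * (guess_factor t e z)^*
    = \sum_(e : bool) guess_factor t e y * guess_factor t e z.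
  apply: eq_bigr => e _; congr (_ * _); apply/CrealP.
  have s2r : s2 \is Num.real by rewrite ger0_real// ltW.
  rewrite /guess_factor /amplitude; case: e; last first.
    by case: t; rewrite ?rpredM ?rpredV ?rpredX ?rpredN ?rpred1 ?rpred_nat.
  rewrite !rpredM ?rpredX ?rpredN ?rpred1// ?rpredV ?ger0_real// ?(ltW s80)//.
  by rewrite sqrtC_ge0; case: ifP.
rewrite big_bool /guess_entry /guess_factor /amplitude i2 i8.
case: t y z => -[] [] /=; rewrite -/a -/b ?i2 ?expr0 ?expr1 ?mul1r ?mulN1r;
  rewrite ?mulrNN ?mulrN ?mulNr ?(mulrC b a) ?aa ?bb ?ab; by field.
Qed.

Local Notation bits N := (N.-tuple bool).

Definition guess_op (N : nat) : 'M[C]_#|{: bits N}| :=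
  \matrix_(j, k) \prod_(i < N)
    guess_entry (tnth (enum_val j) i) (tnth (enum_val k) i).

Definition guess_vec (N : nat) (theta : bits N) (e : {ffun 'I_N -> bool}) :
    'cV[C]_#|{: bits N}| :=
  \col_j \prod_(i < N) guess_factor (tnth theta i) (e i) (tnth (enum_val j) i).

(** Tensoring [guess_entryE] yields one rank-one term for each choice [e] of a summand at every
    qubit. *)
Lemma guess_op_sum (N : nat) (theta : bits N) :
  guess_op N = \sum_e guess_vec theta e *m (guess_vec theta e)^t*.
Proof.
apply/matrixP => j k; rewrite mxE summxE.
rewrite (eq_bigr _ (fun i _ => guess_entryE (tnth theta i) _ _)).
rewrite bigA_distr_bigA /=; apply: eq_bigr => e _.
by rewrite mxE big_ord1 !mxE rmorph_prod -big_split.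
Qed.

Lemma psd_guess_op (N : nat) : psd (guess_op N).
Proof.
rewrite (guess_op_sum [tuple of nseq N false]); apply: psd_sum => e _.
by rewrite -{1}[guess_vec _ e]trmxCK; exact: psd_gram.
Qed.

Definition ket0 (N : nat) (theta : bits N) :=
  ket C [tuple of nseq N false] theta.

Lemma guess_vec0 (N : nat) (theta : bits N) :
  guess_vec theta [ffun=> false] *m (guess_vec theta [ffun=> false])^t*
  = (2 ^+ N)^-1 *: (ket0 theta *m (ket0 theta)^t*).
Proof.
have s0 : 0 < s2 by rewrite sqrtC_gt0 ltr0n.
have -> : guess_vec theta [ffun=> false] = (s2 ^+ N)^-1 *: ket0 theta.
  have -> : (s2 ^+ N)^-1 = \prod_(i < N) s2^-1.
    by rewrite prodr_const card_ord exprVn.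
  apply/colP => j; rewrite !mxE mulrC -big_split; apply: eq_bigr => i _ /=.
  by rewrite ffunE /guess_factor /= tnth_nseq.
rewrite adjmxZ -scalemxAl -scalemxAr scalerA geC0_conj; last first.
  by rewrite invr_ge0 exprn_ge0// ltW.
by rewrite -invfM -exprMn -expr2 sqrtCK.
Qed.

(** The subtracted state is the term of [guess_op_sum] with [e] constantly false; the other terms
    are positive. *)
Lemma guess_op_dominates (N : nat) (theta : bits N) :
  psd (guess_op N - (2 ^+ N)^-1 *: (ket0 theta *m (ket0 theta)^t*)).
Proof.
rewrite (guess_op_sum theta) -guess_vec0 (bigD1 [ffun=> false])//=.
rewrite addrAC subrr add0r.
apply: psd_sum => e _.
by rewrite -{1}[guess_vec _ e]trmxCK; exact: psd_gram.
Qed.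

Lemma guess_op_trace (N : nat) : \tr (guess_op N) = ((2 + s2) / 4) ^+ N.
Proof.
rewrite /mxtrace; under eq_bigr do rewrite mxE.
rewrite (sum_enum_val (fun x : bits N =>
  \prod_(i < N) guess_entry (tnth x i) (tnth x i))) /=.
rewrite (sum_tuple_prod (fun=> fun y => guess_entry y y)) prodr_const card_ord.
by congr (_ ^+ _); rewrite big_bool /guess_entry /=; field.
Qed.

Lemma ket0_trace (N : nat) (theta : bits N) :
  \tr (ket0 theta *m (ket0 theta)^t*) = 1.
Proof.
have s0 : 0 < s2 by rewrite sqrtC_gt0 ltr0n.
pose f i y := amplitude C (tnth [tuple of nseq N false] i) (tnth theta i) y.
pose F (x : bits N) := \prod_(i < N) (f i (tnth x i) * (f i (tnth x i))^*).
rewrite /mxtrace (eq_bigr (fun j => F (enum_val j))).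
  rewrite sum_enum_val (sum_tuple_prod (fun i y => f i y * (f i y)^*)).
  rewrite big1// => i _; rewrite big_bool /f tnth_nseq /amplitude /=.
  case: (tnth theta i); rewrite /= ?expr0 ?mul1r.
    by rewrite geC0_conj ?invr_ge0 ?ltW// -invfM -expr2 sqrtCK; field.
  by rewrite !(mul0r, conjC1, mulr1, add0r).
by move=> j _; rewrite mxE big_ord1 !mxE rmorph_prod -big_split.
Qed.

End Guessing.

(** * Bob's evolution *)

Section Protocol.
Variable C : numClosedFieldType.

(** In the trace against a block diagonal matrix, only the diagonal blocks of the optimal
    contraction count, and these are contractions. *)
Lemma trnorm_mxdiag (V : finType) (d : V -> nat) (A : forall v, 'M[C]_(d v)) :
  exists S : forall v, 'M[C]_(d v), (forall v, contraction (S v)) /\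
    trnorm (\mxdiag_(j < #|{: V}|) A (enum_val j)) = \sum_v \tr (S v *m A v).
Proof.
have [S0 cS0 ->] := trnorm_polar (\mxdiag_(j < #|{: V}|) A (enum_val j)).
pose t j := \tr (submxblock S0 j j *m A (enum_val j)).
have hS0 j : contraction (submxblock S0 j j).
  apply: contraction_mxsub => // k l kl; apply/val_inj/eqP.
  have := @tagnat.eq_Rank _ (fun j => d (enum_val j)) j j k l.
  rewrite eqxx /= => <-.
  by apply/eqP; move/(congr1 val): kl => /=.
(* Block sizes depend on the index, so contractions are moved along [enum_val (enum_rank v) = v]. *)
have transport v w (vw : v = w) (M : 'M[C]_(d v)) : contraction M ->
  exists M' : 'M[C]_(d w), contraction M' /\ \tr (M' *m A w) = \tr (M *m A v).
  by case: w / vw => hM; exists M.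
have ex v : exists M : 'M[C]_(d v),
  contraction M /\ \tr (M *m A v) = t (enum_rank v).
  exact: (transport _ _ (enum_rankK v) _ (hS0 _)).
have [S hS] := fin_all_exists ex.
exists S; split=> [v|]; first by have [] := hS v.
rewrite -[in LHS](submxblockK S0) mul_mxblock_mxdiag mxtrace_mxblock.
rewrite [RHS](reindex (@enum_val V {: V})); last exact/onW_bij/enum_val_bij.
by apply: eq_bigr => j _; have [_ ->] := hS (enum_val j); rewrite enum_valK.
Qed.

Section Measure.
Variables (O : finType) (d d' : nat) (I : instrument C O d d').

Lemma measure_psd o X : psd X -> psd (measure I o X).
Proof. by move=> pX; apply: psd_sum => K _; exact: psd_conj. Qed.

Lemma measureZ o a X : measure I o (a *: X) = a *: measure I o X.
Proof.
rewrite /measure scaler_sumr; apply: eq_bigr => K _.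
by rewrite -scalemxAr -scalemxAl.
Qed.

Lemma measureB o X Y : measure I o (X - Y) = measure I o X - measure I o Y.
Proof.
by rewrite /measure -sumrB; apply: eq_bigr => K _; rewrite mulmxBr mulmxBl.
Qed.

Lemma measure_trace X : \sum_o \tr (measure I o X) = \tr X.
Proof.
case: I => kr hk; rewrite /measure /=.
transitivity (\tr ((\sum_o \sum_(K <- kr o) K^t* *m K) *m X)).
  rewrite mulmx_suml linear_sum; apply: eq_bigr => o _.
  rewrite mulmx_suml !linear_sum; apply: eq_bigr => K _.
  by rewrite /= mxtrace_mulC mulmxA.
by rewrite hk mul1mx.
Qed.

End Measure.

Lemma sum_tuple_rcons (T : finType) (n : nat) (F : seq T -> C) :
  \sum_(h : n.+1.-tuple T) F h = \sum_(h : n.-tuple T) \sum_o F (rcons h o).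
Proof.
rewrite pair_big /=.
rewrite (reindex (fun p : n.-tuple T * T => [tuple of rcons p.1 p.2])) //=.
apply: onW_bij; apply: inj_card_bij.
  move=> [h o] [h' o'] /(congr1 val) /= /rcons_inj [hh ->].
  by congr (_, _); apply: val_inj.
by rewrite card_prod !card_tuple expnSr.
Qed.

Variables (N : nat) (B : dishonest_bob C N).
Local Notation bits := (N.-tuple bool).

(* The operation performed by Bob during the first [i] invocations of 1CC when
   the replies are [h], irrespective of whether Alice's bases allow them. *)
Fixpoint evolve (h : seq (option bool)) (i : nat) (X : 'M[C]_#|{: bits}|) :
    'M[C]_(bob_dim N (Defs.mem B) i) :=
  if i is j.+1 then
    measure (ask B j (take j h)) (isSome (nth None h j)) (evolve h j X)
  else X.

Lemma evolve_rcons h o i X : (i <= size h)%N ->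
  evolve (rcons h o) i X = evolve h i X.
Proof.
elim: i => //= i IH ih.
by rewrite IH ?(ltnW ih)// nth_rcons ih -cats1 takel_cat// ltnW.
Qed.

Lemma evolveZ h i a X : evolve h i (a *: X) = a *: evolve h i X.
Proof. by elim: i => //= i ->; rewrite measureZ. Qed.

Lemma evolveB h i X Y : evolve h i (X - Y) = evolve h i X - evolve h i Y.
Proof. by elim: i => //= i ->; rewrite measureB. Qed.

Lemma evolve_psd h i X : psd X -> psd (evolve h i X).
Proof. by move=> pX; elim: i => //= i IH; exact: measure_psd. Qed.

(* Used with the weights enforcing Alice's bases, for which the sum is Bob's
   total probability, and with weight 1/2 on either answer. *)
Lemma evolve_trace (om : nat -> option bool -> C) i X :
  (forall j, om j None = 1) ->
  (forall j, om j (Some true) + om j (Some false) = 1) ->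
  \sum_(h : i.-tuple (option bool))
    (\prod_(j < i) om j (nth None h j)) * \tr (evolve h i X) = \tr X.
Proof.
move=> om0 om1; elim: i => [|i IH].
  rewrite (bigD1 [tuple])//= big_ord0 mul1r big1 ?addr0// => h.
  by rewrite tuple0.
rewrite (sum_tuple_rcons _ (fun h =>
  (\prod_(j < i.+1) om j (nth None h j)) * \tr (evolve h i.+1 X))) -[RHS]IH.
apply: eq_bigr => h _.
transitivity (\sum_o (\prod_(j < i) om j (nth None h j)) *
    (om i o * \tr (measure (ask B i h) (isSome o) (evolve h i X)))).
  apply: eq_bigr => o _; rewrite big_ord_recr /= mulrA.
  have -> : take i (rcons h o) = h by rewrite -cats1 take_size_cat ?size_tuple.
  have -> : nth None (rcons h o) i = o.
    by rewrite nth_rcons size_tuple ltnn eqxx.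
  rewrite evolve_rcons ?size_tuple//; congr (_ * _ * _).
  by apply: eq_bigr => j _; rewrite nth_rcons size_tuple ltn_ord.
rewrite -mulr_sumr; congr (_ * _).
(* The answers [Some true] and [Some false] share the outcome [true] of Bob's instrument, and their
   weights add up to 1. *)
rewrite -(measure_trace (ask B i h)) big_bool /=.
rewrite (bigD1 None)//= om0 mul1r addrC (bigD1 (Some true))//=.
rewrite (bigD1 (Some false))//= big1 => [|[[]|]//].
by rewrite addr0 -mulrDl om1 mul1r.
Qed.

Definition consistent (theta : bits) (h : seq (option bool)) (i : nat) : bool :=
  [forall j : 'I_i,
    nth None h j == (oneCC (nth false theta j) (isSome (nth None h j))).2].

(** Isolates the dependence on Alice's bases: replies either exclude [theta] or lead to an operation
    common to all [theta], which can also be applied to [guess_op]. *)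
Lemma query_stateE (theta : bits) h i :
  query_state B theta h i =
  if consistent theta h i
  then evolve h i (ket0 C theta *m (ket0 C theta)^t*) else 0.
Proof.
have measure0 O d d' (I : instrument C O d d') o : measure I o 0 = 0.
  by rewrite -[X in measure _ _ X](scale0r 0) measureZ scale0r.
elim: i => [|i IH] /=; first by case: ifP => // /negP[]; apply/forallP => -[].
have -> : consistent theta h i.+1 =
  (nth None h i == (oneCC (nth false theta i) (isSome (nth None h i))).2)
    && consistent theta h i.
  apply/forallP/andP => [c|[ci /forallP c] j].
    split; first exact: (c ord_max).
    by apply/forallP => j; exact: (c (widen_ord (leqnSn i) j)).
  have := ltn_ord j; rewrite ltnS leq_eqVlt => /orP[/eqP->//|ji].
  exact: (c (Ordinal ji)).
by case: eqP => // _; rewrite IH; case: ifP.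
Qed.

(** Checked positions are determined by the replies, the others by the substring. Distinct
    consistent bases thus give distinct hash inputs. *)
Lemma consistent_inj (theta theta' : bits) (h : N.-tuple (option bool)) :
  consistent theta h N -> consistent theta' h N ->
  substring theta (~: checked h) = substring theta' (~: checked h) ->
  theta = theta'.
Proof.
move=> /forallP c /forallP c' /colP x; apply: eq_from_tnth => i.
have := c i; have := c' i; rewrite -!tnth_nth.
case E : (tnth h i) => [b|] /= /eqP e' /eqP e.
  by case: e e' => -> [].
have hi : i \in ~: checked h by rewrite !inE E.
by have := x (enum_rank_in hi i); rewrite !mxE enum_rankK_in.
Qed.

Lemma query_state_trace (theta : bits) :
  \sum_(h : N.-tuple (option bool)) \tr (query_state B theta h N) = 1.
Proof.
(* The product of these indicators is 1 if [theta] is consistent with the replies and 0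
   otherwise. *)
pose om j o : C := (o == (oneCC (nth false theta j) (isSome o)).2)%:R.
rewrite -(ket0_trace C theta) -(@evolve_trace om N); last 2 first.
- by [].
- by move=> j; rewrite /om /=; case: (nth _ _ _); rewrite ?addr0 ?add0r.
apply: eq_bigr => h _; rewrite query_stateE; case: ifP => [/forallP hc|].
  by rewrite big1 ?mul1r// => j _; rewrite /om hc.
move/negbT; rewrite negb_forall => /existsP[j hj].
by rewrite linear0 (bigD1 j)//= /om (negPf hj) !mul0r.
Qed.

(** Each answer to a check has weight 1/2; this controls the growth of the trace when all answers
    are summed. *)
Lemma evolve_trace_answers X :
  \sum_(h : N.-tuple (option bool))
    2 ^- #|checked h| * \tr (evolve h N X) = \tr X.
Proof.
pose om (j : nat) (o : option bool) : C := if isSome o then 2^-1 else 1.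
rewrite -[RHS](@evolve_trace om N)//; last by move=> j; rewrite /om /=; field.
apply: eq_bigr => h _; congr (_ * _).
rewrite -exprVn -prodr_const big_mkcond /=; apply: eq_bigr => i _.
by rewrite inE (tnth_nth None).
Qed.

End Protocol.

(** * Hiding *)

Section Hiding.

Lemma sum_sigT (C : nmodType) (I : finType) (J : I -> finType)
    (F : {i : I & J i} -> C) :
  \sum_p F p = \sum_i \sum_(j : J i) F (Tagged J j).
Proof.
rewrite (sig_big_dep xpredT (fun _ => xpredT)
  (fun i (j : J i) => F (Tagged J j))).
by apply: eq_bigr => -[].
Qed.

Lemma sum_option (C : nmodType) (T : finType) (F : option T -> C) :
  \sum_o F o = F None + \sum_x F (Some x).
Proof.
rewrite (bigD1 None)//=; congr (_ + _).
rewrite (reindex_omap Some id) => [|[]//].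
by apply: eq_bigl => x; rewrite /= eqxx.
Qed.

Lemma hkey_gt0 n (F : hash_family n) : (0 < #|hkey F|)%N.
Proof. by case: F. Qed.

(** The sum is the number of keys that agree on [x] and [y] minus the number that disagree, and at
    most half agree. *)
Lemma two_universal_signs (C : numDomainType) n (F : hash_family n) x y :
  two_universal F -> x != y ->
  \sum_(g : hkey F) (-1) ^+ (hfun g x (+) hfun g y) <= 0 :> C.
Proof.
move=> hF xy; have := hF x y xy.
set E := [set g | _]; have k0 := hkey_gt0 F.
rewrite ler_pdivrMr ?ltr0n// mulrAC mul1r ler_pdivlMr ?ltr0n//.
rewrite -natrM ler_nat => hE.
have -> : \sum_(g : hkey F) (-1) ^+ (hfun g x (+) hfun g y)
    = (#|E| * 2)%:R - #|hkey F|%:R :> C.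
  have -> : #|hkey F|%:R = \sum_(g : hkey F) 1 :> C by rewrite sumr_const.
  rewrite natrM -sum1_card natr_sum mulr_suml [\sum_(g in E) _]big_mkcond.
  rewrite -sumrB; apply: eq_bigr => g _; rewrite inE.
  case: (hfun g x); case: (hfun g y); rewrite /= ?expr0 ?expr1 ?mul1r ?sub0r//.
    by rewrite mulr2n addrK.
  by rewrite mulr2n addrK.
by rewrite subr_le0 ler_nat.
Qed.

Variables (R : realType) (N : nat) (q r : R) (F : forall n, hash_family n).
Variables (H : parity_check_choice) (B : dishonest_bob R[i] N).
Hypothesis hF : forall n, two_universal (F n).
Local Notation bits := (N.-tuple bool).
Local Notation replies := (N.-tuple (option bool)).
Local Notation msg h := (code_msg #|~: checked h|).

Definition view_diff (v : view F N) : 'M[R[i]]_(view_dim B v) :=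
  (#|{: bits}|%:R)^-1 *: \sum_(theta : bits) given_bases q r H B false theta v -
  (#|{: bits}|%:R)^-1 *: \sum_(theta : bits) given_bases q r H B true theta v.

Definition compatible (h : replies) (m : msg h)
    (s : 'cV[bool]_(#|~: checked h| - tag m)) (theta : bits) : bool :=
  consistent theta h N &&
  (s == H (tagged m) *m substring theta (~: checked h)).

(** In [hashed_trace_bound] this is taken as [Sg], and [basis_state] as [T], the latter including
    the prior probability 2^-N of [theta]. *)
Definition guess_state (h : replies) (m : msg h) :=
  measure (announce B h) m (evolve B h N (guess_op _ N)).

Definition basis_state (h : replies) (m : msg h) (theta : bits) :=
  measure (announce B h) m
    (evolve B h N ((2 ^+ N)^-1 *: (ket0 _ theta *m (ket0 _ theta)^t*))).

Definition accepted (h : replies) (m : msg h) : bool :=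
  ~~ too_many q h && accepts r m.

(** Given the view and [theta], a single committed bit explains [w]: false if [w] is the hash value,
    whence sign 1, and true otherwise, whence sign -1. *)
Lemma view_diffE (h : replies) (m : msg h) g s w :
  view_diff (existT _ h (Some (existT _ m (Some (g, s, w))))) =
  if accepted m then
    (#|hkey (F #|~: checked h|)|%:R)^-1 *:
      \sum_(theta | compatible s theta)
        (-1) ^+ (w (+) hfun g (substring theta (~: checked h))) *:
          basis_state m theta
  else 0.
Proof.
set x := fun theta : bits => substring theta (~: checked h).
set K := (#|hkey _|%:R)^-1 : R[i].
pose rho theta := measure (announce B h) m
  (evolve B h N (ket0 _ theta *m (ket0 _ theta)^t*)).
have gbE b theta :
    given_bases q r H B b theta
      (existT _ h (Some (existT _ m (Some (g, s, w))))) =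
    if [&& accepted m, compatible s theta & w == hfun g (x theta) (+) b]
    then K *: rho theta else 0.
  rewrite /= query_stateE /accepted /compatible -/(x theta).
  case: (too_many q h); first exact: erefl.
  case: (accepts r m); last exact: erefl.
  rewrite !andTb; case: (consistent theta h N).
    by case: ifP.
  case: ifP => _; last exact: erefl.
  by rewrite -[X in measure _ _ X](scale0r 0) measureZ scale0r scaler0.
rewrite /view_diff -scalerBr -sumrB.
under eq_bigr do rewrite !gbE.
case: accepted => /=; last first.
  by rewrite big1 ?scaler0// => theta _; rewrite subrr.
rewrite [in RHS]big_mkcond !scaler_sumr; apply: eq_bigr => theta _.
case: (compatible s theta) => /=; last by rewrite subrr !scaler0.
rewrite /basis_state evolveZ measureZ -/(rho theta) card_tuple card_bool natrX.
rewrite !scalerA addbF addbT.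
clear gbE; case: w; case: (hfun g (x theta)) => /=.
all: rewrite ?subr0 ?sub0r ?scalerN scalerA ?expr0 ?expr1.
all: rewrite ?mulN1r ?mulrN ?scaleNr ?mulr1 ?mulN1r.
all: rewrite ?mulrN1 ?mulNr ?scaleNr mulrC //.
Qed.

(** The committed bit enters only through [w], so the views in which Alice aborts cancel, here and
    in [view_diff_abort]. *)
Lemma view_diff_None (h : replies) : view_diff (existT _ h None) = 0.
Proof. by rewrite /view_diff /= subrr. Qed.

Lemma view_diff_abort (h : replies) (m : msg h) :
  view_diff (existT _ h (Some (existT _ m None))) = 0.
Proof. by rewrite /view_diff /= subrr. Qed.

(** The bit [w] occurs in both signs and cancels; [consistent_inj] makes the hash inputs
    distinct. *)
Lemma compatible_hash (C : numDomainType) (h : replies) (m : msg h) s w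
    theta theta' :
  compatible s theta -> compatible (m := m) s theta' -> theta != theta' ->
  \sum_(g : hkey (F #|~: checked h|))
    (-1) ^+ (w (+) hfun g (substring theta (~: checked h))) *
    (-1) ^+ (w (+) hfun g (substring theta' (~: checked h))) <= 0 :> C.
Proof.
move=> /andP[c _] /andP[c' _] tt'.
have xx' : substring theta (~: checked h) != substring theta' (~: checked h).
  by apply: contraNneq tt' => /(consistent_inj c c') ->.
have := two_universal_signs C (@hF _) xx'; apply: le_trans.
apply: ler_sum => g _; rewrite -signr_addb.
by case: w; do 2!case: (hfun g _).
Qed.

Lemma guess_state_psd (h : replies) (m : msg h) : psd (guess_state m).
Proof. exact/measure_psd/evolve_psd/psd_guess_op. Qed.

Lemma basis_state_psd (h : replies) (m : msg h) theta :
  psd (basis_state m theta).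
Proof.
apply/measure_psd/evolve_psd/psdZ; first by rewrite invr_ge0 exprn_ge0.
by rewrite -{1}[ket0 _ _]trmxCK; exact: psd_gram.
Qed.

Lemma basis_state_dominated (h : replies) (m : msg h) theta :
  psd (guess_state m - basis_state m theta).
Proof.
by rewrite -measureB -evolveB; apply/measure_psd/evolve_psd/guess_op_dominates.
Qed.

(** The probability of a key cancels the number of keys in [hashed_trace_bound]. *)
Lemma key_sum_bound (h : replies) (m : msg h) s w (c : R[i])
    (S : forall v : view F N, 'M[R[i]]_(view_dim B v)) :
  (forall v, contraction (S v)) -> 0 < c ->
  \sum_g (let v := existT _ h (Some (existT _ m (Some (g, s, w)))) in
          `|\tr (S v *m view_diff v)|)
  <= (accepted m)%:R * (2^-1 * (c * \tr (guess_state m) +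
       c^-1 * \sum_(theta | compatible s theta) \tr (basis_state m theta))).
Proof.
move=> hS c0 /=; under eq_bigr do rewrite view_diffE.
case: accepted; last first.
  by rewrite mul0r big1// => g _; rewrite mulmx0 linear0 normr0.
rewrite mul1r.
under eq_bigr do rewrite -scalemxAr linearZ /= normrM normfV normr_nat.
have k0 := hkey_gt0 (F #|~: checked h|).
rewrite -mulr_sumr ler_pdivrMl ?ltr0n//.
apply: (hashed_trace_bound (e := fun g theta =>
   w (+) hfun g (substring theta (~: checked h)))
   (S := fun g => S (existT _ h (Some (existT _ m (Some (g, s, w))))))) => //.
- by move=> theta theta'; exact: compatible_hash.
- by move=> g; exact: (hS (existT _ h (Some (existT _ m (Some (g, s, w)))))).
- exact: guess_state_psd.
- by move=> theta _; exact: basis_state_psd.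
- by move=> theta _; exact: basis_state_dominated.
Qed.

(** [guess_state] is the same for every syndrome and is counted once for each, whereas the
    consistent bases are partitioned by their syndromes. *)
Lemma message_sum_bound (h : replies) (m : msg h) (c : R[i])
    (S : forall v : view F N, 'M[R[i]]_(view_dim B v)) :
  (forall v, contraction (S v)) -> 0 < c ->
  \sum_gsw (let v := existT _ h (Some (existT _ m (Some gsw))) in
          `|\tr (S v *m view_diff v)|)
  <= (accepted m)%:R *
      (c * (2 ^+ (#|~: checked h| - tag m) * \tr (guess_state m)) +
       c^-1 * \sum_(theta | consistent theta h N) \tr (basis_state m theta)).
Proof.
move=> hS c0 /=.
pose f g s w : R[i] :=
  let v := existT _ h (Some (existT _ m (Some (g, s, w)))) in
  `|\tr (S v *m view_diff v)|.
have -> : \sum_gsw `|\tr (S (existT _ h (Some (existT _ m (Some gsw)))) *m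
      view_diff (existT _ h (Some (existT _ m (Some gsw)))))|
    = \sum_s \sum_w \sum_g f g s w.
  transitivity (\sum_g \sum_s \sum_w f g s w).
    by rewrite pair_big pair_big /=; apply: eq_bigr => -[[g s] w] _.
  by rewrite exchange_big; apply: eq_bigr => s _; rewrite exchange_big.
pose b (s : 'cV[bool]_(#|~: checked h| - tag m)) : R[i] :=
  (accepted m)%:R * (2^-1 * (c * \tr (guess_state m) +
       c^-1 * \sum_(theta | compatible s theta) \tr (basis_state m theta))).
have le_b : \sum_s \sum_w \sum_g f g s w <= \sum_s \sum_(w : bool) b s.
  by apply: ler_sum => s _; apply: ler_sum => w _; exact: key_sum_bound.
rewrite (le_trans le_b)// le_eqVlt; apply/orP; left; apply/eqP.
(* The two values of [w] absorb the factor 1/2. *)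
transitivity (\sum_(s : 'cV[bool]_(#|~: checked h| - tag m))
    (accepted m)%:R * (c * \tr (guess_state m) +
       c^-1 * \sum_(theta | compatible s theta) \tr (basis_state m theta))).
  apply: eq_bigr => s _; rewrite big_bool /b /= -mulrDr; congr (_ * _).
  by rewrite -mulrDl -[2^-1]mul1r -splitr mul1r.
rewrite -mulr_sumr big_split /= sumr_const -mulr_sumr; congr (_ * (_ + _ * _)).
  have cardE : #|{: 'cV[bool]_(#|~: checked h| - tag m)}|
      = (2 ^ (#|~: checked h| - tag m))%N by rewrite card_mx card_bool muln1.
  by rewrite -[LHS]mulr_natl cardE natrX mulrCA.
rewrite [RHS](partition_big (fun theta =>
  H (tagged m) *m substring theta (~: checked h)) xpredT)//=.
by apply: eq_bigr => s _; apply: eq_bigl => theta; rewrite /compatible eq_sym.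
Qed.

(** With n unchecked positions and dimension k, Alice's check gives [n - k <= (1 - r) n], and
    [n <= N]. *)
Lemma syndrome_bound (h : replies) (m : msg h) : r < 1 -> accepted m ->
  2 ^+ (#|~: checked h| - tag m) <= 2 `^ ((1 - r) * N%:R).
Proof.
move=> r1 /andP[_ /andP[_ hk]].
have kn : (tag m <= #|~: checked h|)%N by rewrite -ltnS.
have nN : (#|~: checked h| <= N)%N by rewrite -[leqRHS](card_ord N) max_card.
rewrite -powR_mulrn// ler_powR ?ler1n// natrB//.
apply: (@le_trans _ _ ((1 - r) * #|~: checked h|%:R)).
  by rewrite mulrBl mul1r lerB.
by rewrite ler_wpM2l ?ler_nat// subr_ge0 ltW.
Qed.

Lemma checked_bound (h : replies) : ~~ too_many q h ->
  2 ^+ #|checked h| <= 2 `^ (2 * q * N%:R).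
Proof.
by rewrite -leNgt => ht; rewrite -powR_mulrn// ler_powR ?ler1n.
Qed.

Lemma guess_state_total (h : replies) :
  \sum_m \tr (guess_state (h := h) m) = \tr (evolve B h N (guess_op _ N)).
Proof. exact: measure_trace. Qed.

Lemma basis_state_total :
  \sum_h \sum_(m : msg h) \sum_(theta | consistent theta h N)
    \tr (basis_state m theta) = 1.
Proof.
transitivity (\sum_(h : replies) \sum_(theta : bits)
    (2 ^+ N)^-1 * \tr (query_state B theta h N)).
  apply: eq_bigr => h _; rewrite exchange_big big_mkcond /=.
  apply: eq_bigr => theta _; rewrite measure_trace evolveZ linearZ /=.
  by rewrite query_stateE; case: ifP; rewrite ?linear0 ?mulr0.
rewrite exchange_big /=.
under eq_bigr do rewrite -mulr_sumr query_state_trace mulr1.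
have cardE : #|{: bits}| = (2 ^ N)%N by rewrite card_tuple card_bool.
rewrite sumr_const cardE -[LHS]mulr_natr natrX mulVf//.
by rewrite expf_neq0 ?pnatr_eq0.
Qed.

Lemma view_sum_bound (c : R[i])
    (S : forall v : view F N, 'M[R[i]]_(view_dim B v)) :
  r < 1 -> (forall v, contraction (S v)) -> 0 < c ->
  \sum_v `|\tr (S v *m view_diff v)|
  <= c * ((2 `^ ((1 - r) * N%:R) * 2 `^ (2 * q * N%:R))%:C%C *
          \tr (guess_op R[i] N)) + c^-1.
Proof.
move=> r1 hS c0; rewrite sum_sigT.
set L := 2 `^ _; set M := 2 `^ _.
have c0' := ltW c0.
have gs0 h m : 0 <= \tr (guess_state (h := h) m).
  exact/psd_tr_ge0/guess_state_psd.
have bs0 h (m : msg h) : 0 <= \sum_(theta | consistent theta h N)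
    \tr (basis_state m theta).
  by apply: sumr_ge0 => theta _; exact/psd_tr_ge0/basis_state_psd.
have toC n : 2 ^+ n = ((2 ^+ n)%:C)%C :> R[i] by rewrite rmorphXn rmorph_nat.
have L0 : 0 <= (L%:C)%C :> R[i] by rewrite ler0c powR_ge0.
have M0 : 0 <= (M%:C)%C :> R[i] by rewrite ler0c powR_ge0.
(* For accepted messages [M] is at least [2 ^+ #|checked h|], which allows inserting the weights of
   [evolve_trace_answers]. Other messages contribute 0, below a nonnegative term. *)
apply: (@le_trans _ _ (\sum_h \sum_(m : msg h)
   (c * ((L%:C)%C * ((M%:C)%C * (2 ^- #|checked h| * \tr (guess_state m)))) +
    c^-1 * \sum_(theta | consistent theta h N) \tr (basis_state m theta)))).
  apply: ler_sum => h _.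
  rewrite sum_option view_diff_None mulmx0 linear0 normr0 add0r.
  rewrite sum_sigT; apply: ler_sum => m _.
  rewrite sum_option view_diff_abort mulmx0 linear0 normr0 add0r.
  have := @message_sum_bound h m c S hS c0; move/le_trans; apply.
  have [acc|_] := boolP (accepted m); last first.
    rewrite mul0r addr_ge0// mulr_ge0// ?invr_ge0// mulr_ge0// mulr_ge0//.
    by rewrite mulr_ge0// invr_ge0 exprn_ge0.
  rewrite mul1r lerD// ler_wpM2l// ler_pM// ?exprn_ge0//.
    by rewrite toC lecR; exact: syndrome_bound.
  rewrite mulrA -[leLHS]mul1r ler_wpM2r// ler_pdivlMr ?exprn_gt0//.
  by rewrite mul1r toC lecR checked_bound//; case/andP: acc.
under eq_bigr do rewrite big_split -!mulr_sumr guess_state_total.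
rewrite big_split -!mulr_sumr basis_state_total mulr1 evolve_trace_answers.
by rewrite rmorphM /= -(mulrA (L%:C)%C).
Qed.

End Hiding.

(** * Evaluation of the constants *)

Section Constants.
Variable R : realType.
Local Notation gamma := (cos (pi / 8) ^+ 2 : R).

Lemma cos_pi8_sqr : gamma = (1 + cos (pi / 4)) / 2.
Proof.
have -> : (pi / 4 : R) = (pi / 8) *+ 2 by rewrite -mulr_natr; field.
by rewrite cos_mulr2n -mulr_natr; field.
Qed.

Lemma cos_pi4_ge0 : 0 <= cos (pi / 4 : R).
Proof.
have p0 := pi_ge0 R.
by apply: cos_ge0_pihalf; apply/andP; split; lra.
Qed.

Lemma sqrtC2_cos : sqrtC 2 = ((2 * cos (pi / 4 : R))%:C)%C.
Proof.
have c2 : cos (pi / 4 : R) ^+ 2 = 1 / 2.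
  have : cos ((pi / 4 : R) *+ 2) = 0.
    have -> : (pi / 4 : R) *+ 2 = pi / 2 by rewrite -mulr_natr; field.
    exact: cos_pihalf.
  by rewrite cos_mulr2n => h; lra.
have h0 : 0 <= ((2 * cos (pi / 4 : R))%:C)%C :> R[i].
  by rewrite ler0c mulr_ge0// cos_pi4_ge0.
rewrite -[RHS]sqrCK//; congr sqrtC.
rewrite -rmorphXn /= exprMn c2.
by rewrite -[LHS](rmorph_nat (real_complex R)); congr (_%:C)%C; field.
Qed.

Lemma guess_op_trace_cos N : \tr (guess_op R[i] N) = ((gamma ^+ N)%:C)%C.
Proof.
rewrite guess_op_trace sqrtC2_cos cos_pi8_sqr rmorphXn /=; congr (_ ^+ _).
have -> : (1 + cos (pi / 4 : R)) / 2 = (2 + 2 * cos (pi / 4)) / 4 by field.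
by rewrite [RHS]fmorph_div rmorphD !rmorph_nat.
Qed.

(** The left side is the constant K of the overview, so that [eps] is its square root. Both sides
    are written as exponentials and their exponents compared. *)
Lemma hiding_constant_sqr (N : nat) (q r : R) :
  let eps := 2 `^ (- (1 / 2 * N%:R * (log2 (1 / gamma) - 2 * q - (1 - r)))) in
  2 `^ ((1 - r) * N%:R) * 2 `^ (2 * q * N%:R) * gamma ^+ N = eps ^+ 2.
Proof.
move=> eps.
have g0 : 0 < gamma.
  by rewrite cos_pi8_sqr divr_gt0// ltr_pwDl// cos_pi4_ge0.
have l2 : ln 2 != 0 :> R by rewrite gt_eqF// ln_gt0// ltr1n.
rewrite -powR_mulrn ?ltW// /eps /log2 (div1r gamma) lnV ?posrE//.
rewrite /powR !pnatr_eq0 /= (gt_eqF g0) [RHS]expr2 -!expRD.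
congr (sequences.expR _).
by field.
Qed.

End Constants.

Theorem theorem3 (R : realType) (N : nat) (q tau r : R)
    (F : forall n : nat, hash_family n) (H : parity_check_choice)
    (hq0 : 0 < q) (hq1 : q < 1) (htau : 0 < tau) (hr : r < 1)
    (hF : forall n : nat, two_universal (F n)) (hH : parity_checks H) :
  let gamma : R := cos (pi / 8) ^+ 2 in
  hiding (commit_1CC N q tau r F H)
    (2 `^ (- (1 / 2 * N%:R * (log2 (1 / gamma) - 2 * q - (1 - r))))).
Proof.
move=> gamma B; set eps := 2 `^ _.
have eps0 : 0 < eps by exact: powR_gt0.
rewrite /trdist; set D := rstate B false - rstate B true.
have -> : D = \mxdiag_(j < #|{: view F N}|) view_diff q r H B (enum_val j).
  by rewrite /D /= /bob_state -mxdiagB.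
have [S [hS tE]] := trnorm_mxdiag (@view_diff R N q r F H B).
(* For [c = eps^-1] both terms of [view_sum_bound] equal [eps]; the factor 1/2 in the trace distance
   leaves one [eps]. *)
have epsC0 : 0 < ((eps%:C)%C)^-1 :> R[i] by rewrite invr_gt0 (ltcR 0).
have := view_sum_bound q H hF hr hS epsC0.
rewrite guess_op_trace_cos -rmorphM hiding_constant_sqr -/eps rmorphXn /= invrK.
rewrite expr2 mulKf ?gt_eqF ?(ltcR 0)// => bound.
rewrite mulrC ler_pdivrMr ?ltr0n// mulr2n mulrDr mulr1.
apply: le_trans bound.
by rewrite -[leLHS]ger0_norm ?trnorm_ge0// tE ler_norm_sum.
Qed.
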